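(* Let $N=N(n)=\binom{n}{\lfloor n/2\rfloor}$ and let $ex(n,Q_2)$ be the largest size of a $Q_2$-free family of subsets of $[n]$. Then, as $n\to\infty$, $$2N-o(N)\ \leq\ ex(n,Q_2)\ \leq\ 2.283261\,N+o(N).$$ That is, every $Q_2$-free family $\mathcal{F}$ of subsets of $[n]$ satisfies $|\mathcal{F}|\leq 2.283261N+o(N)$ (the error term depending only on $n$), and for each $n$ there is a $Q_2$-free family of subsets of $[n]$ of size at least $2N-o(N)$.
   Context: $[n]=\{1,\dots,n\}$, and families of subsets of $[n]$ are ordered by inclusion. A poset $P=(X,\leq)$ is a subposet of $Q=(Y,\leq')$ if there is an injective map $f:X\to Y$ such that $x_1\leq x_2$ implies $f(x_1)\leq' f(x_2)$ (the converse implication is not required). $Q_2$ is the 2-dimensional Boolean lattice: the poset with four distinct elements $a,b,c,d$ with $a<b,c<d$. A family $\mathcal{F}\subseteq 2^{[n]}$ is $Q_2$-free if $(\mathcal{F},\subseteq)$ does not contain $Q_2$ as a subposet, i.e., there are no four distinct sets $A,B,C,D\in\mathcal{F}$ with $A\subset B\subset D$ and $A\subset C\subset D$. The notation $o(N)$ denotes a function $g(n)$ with $g(n)/N(n)\to 0$ as $n\to\infty$. *)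

(* Defs.v *)
From HB Require Import structures.
From mathcomp Require Import all_boot all_order all_algebra.
From mathcomp Require Import all_classical all_reals all_analysis.

Set Implicit Arguments.
Unset Strict Implicit.
Unset Printing Implicit Defensive.

Import Order.TTheory GRing.Theory Num.Theory.
Import Order.DefaultSetSubsetOrder.
Import numFieldNormedType.Exports.

(* Weak containment: an order-preserving injection, not an order embedding. *)
Definition is_subposet (d d' : Order.disp_t)
    (P : porderType d) (Q : porderType d') : Prop :=
  exists f : P -> Q, injective f /\ {homo f : x y / (x <= y)%O >-> (x <= y)%O}.

(* The type {set T} is ordered by inclusion (DefaultSetSubsetOrder), so the
   2-dimensional Boolean lattice is the poset of all subsets of a 2-set. *)
Definition Q2 : porderType _ := {set 'I_2}.

Section FamilyPoset.
Context (n : nat) (F : {set {set 'I_n}}).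

(* The members of F, with the order induced by inclusion; [n] is encoded as
   'I_n = {0, ..., n - 1}. *)
Definition family : Type := {A : {set 'I_n} | A \in F}.

HB.instance Definition _ := SubChoice.on family.
HB.instance Definition _ := [SubChoice_isSubPOrder of family by <: with Order.SetSubsetOrder.subset_display].

Definition Q2_free : Prop := ~ is_subposet Q2 family.

End FamilyPoset.

Section Extremal.
Local Open Scope nat_scope.

Definition ex_Q2 (n : nat) : nat :=
  \max_(F : {set {set 'I_n}} | `[< Q2_free F >]) #|F|.

Definition midbin (n : nat) : nat := 'C(n, n./2).

End Extremal.

Definition is_little_o (R : realType) (g N : nat -> R) : Prop :=
  ((fun n => g n / N n)%R @ \oo --> (0 : R)%R)%classic.

Lemma family_leE n (F : {set {set 'I_n}}) (A B : family F) :
  (A <= B)%O = (val A \subset val B).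
Proof. by []. Qed.

Lemma Q2_freeE n (F : {set {set 'I_n}}) :
  Q2_free F <->
  ~ exists A B C D : {set 'I_n},
      [/\ uniq [:: A; B; C; D],
          [/\ A \in F, B \in F, C \in F & D \in F],
          A \proper B /\ B \proper D & A \proper C /\ C \proper D].
Proof.
split=> free H; apply: free; last first.
  case: H => f [finj fhomo].
  pose a := f finset.set0; pose d := f [set: 'I_2].
  pose b := f [set ord0]; pose c := f [set ord_max].
  have neq (X Y : {set 'I_2}) : X != Y -> val (f X) != val (f Y).
    by rewrite (inj_eq val_inj) (inj_eq finj).
  have prop (X Y : {set 'I_2}) : X \proper Y -> val (f X) \proper val (f Y).
    move=> XY; rewrite finset.properEneq neq ?finset.proper_neq//=.
    by have := fhomo _ _ (fintype.proper_sub XY : (X <= Y)%O).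
  have p0 (i : 'I_2) : finset.set0 \proper [set i].
    by rewrite fintype.properE finset.sub0set finset.subset0 -cards_eq0 cards1.
  have pT (i : 'I_2) : [set i] \proper [set: 'I_2].
    by rewrite finset.properEcard finset.subsetT cards1 cardsT card_ord.
  have pbc : val b != val c.
    by apply: neq; apply/eqP => /finset.setP/(_ ord0); rewrite !inE.
  have ab := prop _ _ (p0 ord0); have ac := prop _ _ (p0 ord_max).
  have bd := prop _ _ (pT ord0); have cd := prop _ _ (pT ord_max).
  exists (val a), (val b), (val c), (val d); split=> //.
  - rewrite /= !inE !negb_or pbc (finset.proper_neq ab) (finset.proper_neq ac).
    rewrite (finset.proper_neq bd) (finset.proper_neq cd) !andbT /=.
    by rewrite (finset.proper_neq (fintype.proper_trans ab bd)).
  - by split; apply: valP.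
case: H => A [B [C [D [uABCD [FA FB FC FD] [AB BD] [AC CD]]]]].
pose i0 : 'I_2 := ord0; pose i1 : 'I_2 := ord_max.
pose f (X : {set 'I_2}) : family F :=
  if i0 \in X then
    if i1 \in X then exist _ D FD else exist _ B FB
  else if i1 \in X then exist _ C FC else exist _ A FA.
have sAD : A \subset D := fintype.subset_trans (fintype.proper_sub AB) (fintype.proper_sub BD).
have ex2 (X Y : {set 'I_2}) :
    (i0 \in X) = (i0 \in Y) -> (i1 \in X) = (i1 \in Y) -> X = Y.
  move=> e0 e1; apply/finset.setP => i.
  by case: i => [[|[|//]] lti]; [have -> : Ordinal lti = i0 by apply: val_inj
                               |have -> : Ordinal lti = i1 by apply: val_inj].
exists f; split=> [X Y /(congr1 val)|X Y sXY].
  move: uABCD; rewrite /= !inE !negb_or !andbT => /andP[/and3P[nAB nAC nAD]].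
  move=> /andP[/andP[nBC nBD] nCD].
  rewrite /f => E; apply: ex2; move: E;
    do 4?[case: ifP => _]; rewrite //= => E; move: nAB nAC nAD nBC nBD nCD;
    by rewrite E eqxx.
have s0 := fintype.subsetP (sXY : X \subset Y) i0.
have s1 := fintype.subsetP (sXY : X \subset Y) i1.
rewrite family_leE /f; move: s0 s1.
by case: (i0 \in X); case: (i1 \in X); case: (i0 \in Y); case: (i1 \in Y);
  move=> s0 s1 //=; rewrite ?fintype.subxx ?(fintype.proper_sub AB)
    ?(fintype.proper_sub BD) ?(fintype.proper_sub AC) ?(fintype.proper_sub CD) //;
  first [by have := s0 isT | by have := s1 isT].
Qed.

Lemma Q2_free0 n : Q2_free (finset.set0 : {set {set 'I_n}}).
Proof. by apply/Q2_freeE => -[A [B [C [D [_ [+ _ _ _] _ _]]]]]; rewrite inE. Qed.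

Lemma leq_ex_Q2 n (F : {set {set 'I_n}}) : Q2_free F -> (#|F| <= ex_Q2 n)%N.
Proof.
by move=> free; apply: (leq_bigmax_cond (F := fun F => #|pred_of_set F|)); apply/asboolP.
Qed.

Lemma ex_Q2_attained n : exists2 F : {set {set 'I_n}}, Q2_free F & #|F| = ex_Q2 n.
Proof.
have h : (0 < #|[pred F : {set {set 'I_n}} | `[< Q2_free F >]]|)%N.
  by apply/card_gt0P; exists finset.set0; rewrite inE; apply: Q2_free0.
have [F FP EF] := eq_bigmax_cond (fun F : {set {set 'I_n}} => #|F|) h.
by exists F; [move: FP; rewrite inE|rewrite -EF; apply: eq_bigl].
Qed.

(* Main.v *)
Require Import Defs.
From mathcomp Require Import all_boot all_order all_algebra ring lra zify.
Set Implicit Arguments.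
Unset Strict Implicit.
Unset Printing Implicit Defensive.
Import Order.TTheory GRing.Theory Num.Theory.
Local Open Scope ring_scope.

(** The lower bound comes from two consecutive middle layers, which contain no
    chain of three sets.

    For the upper bound, let F be Q_2-free.  Sets whose complement has fewer
    than 150 elements are o(N) in number and are discarded.  A set Y lies on a
    uniformly random maximal chain with probability 1 / C(n, |Y|) >= 1 / N, so
    it suffices to show that such a chain contains at most 2.283261 members of
    F on average.  By optional stopping ([upsum_le_stop]) it suffices to
    consider chains started at a member A of F.  There A itself counts for 1,
    and the family G of members strictly above A has the property that no
    member of G strictly contains two others.  What is needed is that a random
    chain above A meets G at most 41/32 + O(1/m) times on average, where m is
    the number of elements outside A.

    A chain meets G at most twice, first in a member that is minimal in G (a
    bottom), then in one that strictly contains the bottom (a top).  So the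
    mean number of hits from some set W of the chain on is at most 1 plus the
    probability of hitting both kinds ([upsum_ind_le]).  When the chain is read
    downwards from a top Y of relative size y = |Y \ A|, the unique bottom
    below it, of relative size x, is hit with probability 1 / C(y, x), which is
    at most 1/4 as soon as x >= 3 ([upsum_comp], [high_bots_mean]).

    Let W add to A the first three elements i, j, k of the chain, and let l be
    the number of members of G among the six sets obtained by adding to A one
    or two of i, j, k.  If l >= 2, nothing above W is in G; if l = 1, there is
    at most one hit from W on; if l = 0, the two previous remarks bound the
    mean number of hits from W on by 1 + 1/4.  As the six sets themselves are
    hit l / 3 times on average, the mean number of hits is at most the mean of
    [payoff l] over all triples ([upsum_tsum_payoff]).

    What remains is an extremal problem about triples in a graph, the edges
    being the members of relative size 2, with some vertices marked, those
    giving members of relative size 1; no edge joins two marked vertices.  It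
    is solved by a sum of squares: a weight [wt v x] with values 3 and -1 is
    chosen so that 96 payoff + sum_v (wt v x)(wt v y) <= 123 on each triple,
    whereas sum_v (sum_x wt v x)^2 >= 0 ([payoff_wt], [tsum_payoff_le]).  Four
    disjoint cliques of equal size, without marked vertices, show that the
    bound 123 / 96 = 41 / 32 cannot be improved in this step. *)

(** * Sums along a random maximal chain *)

Section UpSum.
Context {R : realFieldType} {T : finType}.
Implicit Types (f g : {set T} -> R) (A X Y : {set T}).

(** Along a uniformly random maximal chain from X to the full set, a set Y
    containing X is met with probability 1 / C(#|~: X|, #|Y :\: X|); this is
    the mean of the sum of f over the sets of that chain. *)
Definition upsum f X : R :=
  \sum_(Y : {set T} | X \subset Y) f Y / 'C(#|~: X|, #|Y :\: X|)%:R.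

Lemma bin_up_gt0 X Y : (0 < 'C(#|~: X|, #|Y :\: X|))%N.
Proof. by rewrite bin_gt0 subset_leq_card // setDE subsetIr. Qed.

Lemma upsumD1 f X :
  upsum f X =
    f X + \sum_(Y : {set T} | X \proper Y) f Y / 'C(#|~: X|, #|Y :\: X|)%:R.
Proof.
rewrite /upsum (bigD1 X) //= setDv cards0 bin0 divr1; congr (_ + _).
by apply: eq_bigl => Y; rewrite properEneq eq_sym andbC.
Qed.

Lemma card_setC_U1 X i : i \notin X -> #|~: X| = #|~: (i |: X)|.+1.
Proof.
move=> iX; rewrite (cardsD1 i (~: X)) inE iX add1n setCU setIC.
by rewrite -setDE.
Qed.

(** The next set of the chain after X is i |: X for a uniform i outside X.  For
    X the full set the division by 0 gives 0, as it should. *)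
Lemma upsum_rec f X :
  upsum f X = f X + (\sum_(i in ~: X) upsum f (i |: X)) / #|~: X|%:R.
Proof.
rewrite upsumD1; congr (_ + _); rewrite /upsum.
rewrite (exchange_big_dep (fun Y : {set T} => X \proper Y)) /=; last first.
  move=> i Y; rewrite inE => iX; rewrite subUset sub1set => /andP[iY XY].
  by apply/properP; split => //; exists i.
rewrite mulr_suml; apply: eq_bigr => Y XpY.
have [XY _] := andP XpY.
have -> : \sum_(i in ~: X | i |: X \subset Y)
    f Y / 'C(#|~: (i |: X)|, #|Y :\: (i |: X)|)%:R =
  \sum_(i in Y :\: X) f Y / 'C(#|~: X|.-1, #|Y :\: X|.-1)%:R.
  apply: eq_big => i; first by rewrite !inE subUset sub1set XY andbT.
  rewrite inE subUset sub1set => /and3P[iX iY _].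
  have -> : #|Y :\: (i |: X)| = #|Y :\: X|.-1.
    rewrite (cardsD1 i (Y :\: X)) !inE iX iY add1n /=.
    by apply: eq_card => z; rewrite !inE negb_or andbA.
  by rewrite (card_setC_U1 iX).
rewrite sumr_const -(mulr_natr (f Y / _)).
have d0 : (0 < #|Y :\: X|)%N.
  by rewrite card_gt0 setD_eq0; move: XpY; rewrite properE => /andP[].
have cd : (#|Y :\: X| <= #|~: X|)%N by rewrite subset_leq_card // setDE subsetIr.
have := mul_bin_diag #|~: X| #|Y :\: X|.-1; rewrite prednK //.
have b0 : (0 < 'C(#|~: X|.-1, #|Y :\: X|.-1))%N by rewrite bin_gt0; lia.
have b1 : (0 < 'C(#|~: X|, #|Y :\: X|))%N by rewrite bin_gt0.
move: (#|Y :\: X|) (#|~: X|) d0 cd b0 b1 => d c d0 cd b0 b1.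
move=> /(congr1 (fun k : nat => k%:R : R)); rewrite !natrM.
have c0 : c%:R != 0 :> R by rewrite pnatr_eq0; lia.
have {}b0 : 'C(c.-1, d.-1)%:R != 0 :> R by rewrite pnatr_eq0; lia.
have {}b1 : 'C(c, d)%:R != 0 :> R by rewrite pnatr_eq0; lia.
move: (c%:R : R) (d%:R : R) ('C(c.-1,d.-1)%:R : R) ('C(c,d)%:R : R) b0 b1 c0.
move=> u v w x w0 x0 u0 E.
apply/eqP; rewrite -subr_eq0; apply/eqP.
have -> : f Y / x - f Y / w * v / u = f Y * (u * w - v * x) / (x * w * u).
  by field; rewrite w0 x0 u0.
by rewrite E subrr mulr0 mul0r.
Qed.

Lemma upsum_eq0 f X :
  (forall Y, X \subset Y -> f Y = 0) -> upsum f X = 0.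
Proof. by move=> f0; rewrite /upsum big1 // => Y /f0->; rewrite mul0r. Qed.

Lemma eq_upsum f g X :
  (forall Y, X \subset Y -> f Y = g Y) -> upsum f X = upsum g X.
Proof. by move=> E; apply: eq_bigr => Y /E->. Qed.

Lemma upsumD f g X : upsum (fun Y => f Y + g Y) X = upsum f X + upsum g X.
Proof. by rewrite /upsum -big_split; apply: eq_bigr => Y _; rewrite mulrDl. Qed.

Lemma upsum_ge0 f X : (forall Y, X \subset Y -> 0 <= f Y) -> 0 <= upsum f X.
Proof. by move=> f0; apply: sumr_ge0 => Y /f0 ?; rewrite divr_ge0 ?ler0n. Qed.

Lemma upsumZ (c : R) f X : upsum (fun Y => c * f Y) X = c * upsum f X.
Proof. by rewrite /upsum mulr_sumr; apply: eq_bigr => Y _; rewrite mulrA. Qed.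

Lemma ler_upsum f g X :
  (forall Y, X \subset Y -> f Y <= g Y) -> upsum f X <= upsum g X.
Proof.
move=> le; apply: ler_sum => Y /le fg.
by rewrite ler_wpM2r // invr_ge0 ler0n.
Qed.

(** Optional stopping: run the chain from X until it first meets the support of
    f.  Nothing is collected before that, and at most c is expected after. *)
Lemma upsum_le_stop f (c : R) : 0 <= c ->
  (forall Y, f Y != 0 -> upsum f Y <= c) -> forall X, upsum f X <= c.
Proof.
move=> c0 stop X; have [k] := ubnP #|~: X|; elim: k X => // k IH X; rewrite ltnS => le.
have [fX|] := eqVneq (f X) 0; last exact: stop.
rewrite upsum_rec fX add0r.
have [->|m0] := posnP #|~: X|; first by rewrite invr0 mulr0.
rewrite ler_pdivrMr ?ltr0n //.
have -> : c * #|~: X|%:R = \sum_(i in ~: X) c by rewrite sumr_const mulr_natr.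
apply: ler_sum => i; rewrite inE => iX; apply: IH.
by move: le; rewrite (card_setC_U1 iX).
Qed.

End UpSum.

(** * Sums over ordered triples of distinct elements *)

Section TripleSum.
Context {R : realFieldType} {T : finType}.
Implicit Types (V : {set T}) (h : T -> T -> T -> R).

Definition tsum V h : R :=
  \sum_(i in V) \sum_(j in V :\ i) \sum_(k in V :\ i :\ j) h i j k.

Lemma tsum_swap12 V h : tsum V (fun i j k => h j i k) = tsum V h.
Proof.
rewrite /tsum (exchange_big_dep [in V]) /=; last by move=> i j _; rewrite inE => /andP[].
apply: eq_bigr => i iV; apply: eq_big => [j|j _].
  by rewrite !inE iV andbT andbC eq_sym.
by apply: eq_bigl => k; rewrite !inE andbCA.
Qed.

Lemma tsum_swap23 V h : tsum V (fun i j k => h i k j) = tsum V h.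
Proof.
apply: eq_bigr => i iV; rewrite (exchange_big_dep [in V :\ i]) /=; last first.
  by move=> j k _; rewrite inE => /andP[].
apply: eq_bigr => j jV; apply: eq_bigl => k; move: jV.
rewrite !inE => /andP[-> ->]; rewrite andbT andbC eq_sym.
by case: (k == j); case: (k == i).
Qed.

Lemma tsumD V h h' :
  tsum V (fun i j k => h i j k + h' i j k) = tsum V h + tsum V h'.
Proof.
rewrite /tsum -big_split; apply: eq_bigr => i _ /=.
by rewrite -big_split; apply: eq_bigr => j _ /=; rewrite -big_split.
Qed.

Lemma tsumZ V (c : R) h :
  tsum V (fun i j k => c * h i j k) = c * tsum V h.
Proof.
rewrite /tsum mulr_sumr; apply: eq_bigr => i _.
by rewrite mulr_sumr; apply: eq_bigr => j _; rewrite mulr_sumr.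
Qed.

Lemma eq_tsum V h h' :
  (forall i j k, i \in V -> j \in V -> k \in V -> i != j -> i != k -> j != k ->
     h i j k = h' i j k) -> tsum V h = tsum V h'.
Proof.
move=> E; apply: eq_bigr => i iV; apply: eq_bigr => j; rewrite !inE => /andP[ji jV].
apply: eq_bigr => k; rewrite !inE => /and3P[kj ki kV].
by apply: E; rewrite // eq_sym.
Qed.

Lemma ler_tsum V h h' :
  (forall i j k, i \in V -> j \in V -> k \in V -> i != j -> i != k -> j != k ->
     h i j k <= h' i j k) -> tsum V h <= tsum V h'.
Proof.
move=> E; apply: ler_sum => i iV; apply: ler_sum => j; rewrite !inE => /andP[ji jV].
apply: ler_sum => k; rewrite !inE => /and3P[kj ki kV].
by apply: E; rewrite // eq_sym.
Qed.

Lemma card_setD1_in V i : i \in V -> #|V :\ i| = #|V|.-1.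
Proof. by move=> iV; rewrite (cardsD1 i V) iV. Qed.

Lemma tsum_const V (c : R) :
  tsum V (fun _ _ _ => c) = (#|V| * #|V|.-1 * #|V|.-2)%:R * c.
Proof.
transitivity (\sum_(i in V) c *+ #|V|.-2 *+ #|V|.-1).
  apply: eq_bigr => i iV; rewrite -(card_setD1_in iV) -sumr_const.
  by apply: eq_bigr => j jV; rewrite sumr_const (card_setD1_in jV) (card_setD1_in iV).
by rewrite sumr_const !natrM; ring.
Qed.

(** For each i the sum over j and k would be the square of a sum, hence
    nonnegative, if j = k were allowed; the missing diagonal terms cost at most
    b each. *)
Lemma tsum_sqr_ge V (w : T -> T -> R) (b : R) :
  (forall i j, w i j ^+ 2 <= b) ->
  - (b * (#|V| ^ 2)%:R) <= tsum V (fun i j k => w i j * w i k).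
Proof.
move=> wb.
have b0 : 0 <= b \/ V = set0.
  have [->|[i _]] := set_0Vmem V; [by right|left].
  exact: le_trans (sqr_ge0 _) (wb i i).
case: b0 => [b0|->]; last by rewrite cards0 mulr0 oppr0 /tsum big_set0.
have -> : - (b * (#|V| ^ 2)%:R) = \sum_(i in V) - (b * #|V|%:R).
  by rewrite sumr_const -[RHS](mulr_natl _ #|V|) expnS expn1 natrM; ring.
apply: ler_sum => i iV.
have -> : \sum_(j in V :\ i) \sum_(k in V :\ i :\ j) w i j * w i k =
   (\sum_(j in V :\ i) w i j) ^+ 2 - \sum_(j in V :\ i) w i j ^+ 2.
  rewrite expr2 mulr_suml -sumrB; apply: eq_bigr => j jV.
  rewrite -mulr_sumr (big_setD1 _ jV) /= mulrDr expr2; ring.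
have h1 : 0 <= (\sum_(j in V :\ i) w i j) ^+ 2 by exact: sqr_ge0.
have h2 : \sum_(j in V :\ i) w i j ^+ 2 <= b * #|V|%:R.
  apply: (@le_trans _ _ (\sum_(j in V :\ i) b)); first by apply: ler_sum.
  rewrite sumr_const -[leLHS]mulr_natr ler_wpM2l // ler_nat subset_leq_card //.
  exact: subD1set.
lra.
Qed.

End TripleSum.

(** * Densities of triples in a marked graph *)

Section TripleDensity.
Context {R : realFieldType} {T : finType}.
Variables (V : {set T}) (s : pred T) (e : rel T).
Hypothesis e_sym : symmetric e.
Hypothesis e_s : forall i j, i \in V -> j \in V -> i != j -> e i j -> ~~ (s i && s j).

Definition incidence i j k : nat := s i + s j + s k + e i j + e i k + e j k.

(** The term l / 3 is there because a chain through the triple meets each of the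
    three singles and of the three pairs with probability 1/3; the other terms
    bound the mean number of hits from the triple on. *)
Definition payoff (l : nat) : R := l%:R / 3 + (l <= 1)%N%:R + (l == 0)%N%:R / 4.

(** For an unmarked graph, [payoff] is extremal for four disjoint cliques of equal
    size: a vertex v is then joined to a quarter of the others, and
    x |-> wt v x has mean 0.  The values at marked vertices are found by solving
    the linear constraints in [payoff_wt]. *)
Definition wt (v x : T) : R := if s x (+) (~~ s v && e v x) then 3 else -1.

Lemma payoff_wt i j k :
  i \in V -> j \in V -> k \in V -> i != j -> i != k -> j != k ->
  96 * payoff (incidence i j k) + wt i j * wt i k + wt j i * wt j k + wt k i * wt k j <= 123.
Proof.
move=> iV jV kV ij ik jk; have := e_s iV jV ij; have := e_s iV kV ik.
have := e_s jV kV jk; rewrite /payoff /incidence /wt.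
rewrite (e_sym j i) (e_sym k i) (e_sym k j).
case: (s i); case: (s j); case: (s k); case: (e i j); case: (e i k); case: (e j k);
  move=> h1 h2 h3; try (by have := h1 isT); try (by have := h2 isT);
  try (by have := h3 isT); rewrite /=; lra.
Qed.

Lemma tsum_payoff_le :
  tsum V (fun i j k => payoff (incidence i j k)) <=
    41 / 32 * (#|V| * #|V|.-1 * #|V|.-2)%:R + 9 / 32 * (#|V| ^ 2)%:R.
Proof.
have sq : - (9 * (#|V| ^ 2)%:R) <= tsum V (fun i j k => wt i j * wt i k).
  by apply: tsum_sqr_ge => i j; rewrite /wt; case: ifP => _; lra.
have sq2 : tsum V (fun i j k => wt j i * wt j k) = tsum V (fun i j k => wt i j * wt i k).
  exact: (tsum_swap12 V (fun i j k => wt i j * wt i k)).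
have sq3 : tsum V (fun i j k => wt k i * wt k j) = tsum V (fun i j k => wt i j * wt i k).
  by rewrite -sq2 -tsum_swap23.
have := ler_tsum payoff_wt.
rewrite 3!tsumD tsumZ sq2 sq3 (tsum_const _ 123); move: sq.
move: (tsum V _) (tsum V _) (_ ^ 2)%:R (_ * _ * _)%:R => p q u v; lra.
Qed.

End TripleDensity.

(** * Chains through triples *)

Section ChainTriples.
Context {R : realFieldType} {T : finType}.
Implicit Types (f g : {set T} -> R) (A X Y : {set T}).

Lemma upsum_avg f X :
  \sum_(i in ~: X) (f X + upsum f (i |: X)) = #|~: X|%:R * upsum f X.
Proof.
rewrite [in RHS]upsum_rec big_split /= sumr_const -(mulr_natl _ #|_|).
have [E|m0] := posnP #|~: X|.
  by rewrite E !mul0r big_pred0 ?addr0 // => i; rewrite (cards0_eq E) inE.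
by field; rewrite pnatr_eq0 -lt0n.
Qed.

(** Three steps of [upsum_rec]: the first three elements added to A form a uniform
    ordered triple of distinct elements. *)
Lemma upsum_triple f A :
  tsum (~: A) (fun i j k => f A + f (i |: A) + f (j |: (i |: A))
                            + upsum f (k |: (j |: (i |: A)))) =
  (#|~: A| * #|~: A|.-1 * #|~: A|.-2)%:R * upsum f A.
Proof.
have CU X i : ~: X :\ i = ~: (i |: X).
  by apply/setP => z; rewrite !inE negb_or.
transitivity (\sum_(i in ~: A) #|~: A|.-1%:R * (#|~: A|.-2%:R * (f A + upsum f (i |: A)))).
  apply: eq_bigr => i iA; rewrite -(card_setD1_in iA).
  transitivity (\sum_(j in ~: A :\ i) #|~: A :\ i|.-1%:R * (f A + (f (i |: A) + upsum f (j |: (i |: A))))).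
    apply: eq_bigr => j jA; rewrite -(card_setD1_in jA) !CU.
    under eq_bigr do rewrite -addrA.
    rewrite big_split /= upsum_avg sumr_const; ring.
  rewrite -mulr_sumr big_split /= sumr_const !CU upsum_avg.
  by rewrite -CU; ring.
rewrite -!mulr_sumr upsum_avg !natrM; ring.
Qed.

(** Both sides count the chains of a subset of size x inside one of size y. *)
Lemma bin_trinomial a y x : (x <= y <= a)%N ->
  ('C(a, x) * 'C(a - x, y - x) = 'C(a, y) * 'C(y, x))%N.
Proof.
move=> /andP[xy ya].
have h1 := bin_fact (leq_trans xy ya).
have h2 : ('C(a - x, y - x) * ((y - x)`! * (a - y)`!) = (a - x)`!)%N.
  have := @bin_fact (a - x) (y - x) (leq_sub2r _ ya).
  by rewrite (_ : a - x - (y - x) = a - y)%N //; lia.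
have h3 := bin_fact ya; have h4 := bin_fact xy.
apply/eqP; rewrite -(eqn_pmul2r (_ : 0 < x`! * ((y - x)`! * (a - y)`!))%N); last first.
  by rewrite !muln_gt0 !fact_gt0.
apply/eqP; transitivity (a`!).
  by rewrite -h1 -h2; ring.
by rewrite -h3 -h4; ring.
Qed.

(** A chain from A meets X and later Y with probability p(X) p(Y | X), which
    equals p(Y) times the probability that a random chain from A to Y meets
    X. *)
Lemma upsum_comp f g A :
  upsum (fun X => f X * upsum g X) A =
  upsum (fun Y => g Y * \sum_(X : {set T} | (A \subset X) && (X \subset Y))
                            f X / 'C(#|Y :\: A|, #|X :\: A|)%:R) A.
Proof.
rewrite /upsum.
under eq_bigr do rewrite mulr_sumr mulr_suml.
rewrite (exchange_big_dep (fun Y : {set T} => A \subset Y)) /=; last first.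
  by move=> X Y; apply: subset_trans.
apply: eq_bigr => Y AY; rewrite mulr_sumr mulr_suml; apply: eq_bigr => X /andP[AX XY].
have := @bin_trinomial #|~: A| #|Y :\: A| #|X :\: A|.
rewrite (subset_leq_card (setSD A XY)) subset_leq_card ?setDE ?subsetIr // => /(_ isT).
rewrite -!setDE.
have -> : (#|~: A| - #|X :\: A| = #|~: X|)%N.
  have := cardsC A; have := cardsC X; have := cardsD X A.
  by rewrite (setIidPr AX); have := subset_leq_card AX; lia.
have -> : (#|Y :\: A| - #|X :\: A| = #|Y :\: X|)%N.
  rewrite !cardsD (setIidPr AX) (setIidPr AY) (setIidPr XY).
  by have := subset_leq_card AX; have := subset_leq_card XY; lia.
have b1 := bin_up_gt0 A X; have b2 := bin_up_gt0 X Y; have b3 := bin_up_gt0 A Y.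
have b4 : (0 < 'C(#|Y :\: A|, #|X :\: A|))%N.
  by rewrite bin_gt0 (subset_leq_card (setSD A XY)).
move=> /(congr1 (fun k : nat => k%:R : R)); rewrite !natrM.
move: b1 b2 b3 b4; rewrite -!(ltr0n R) => /lt0r_neq0 b1 /lt0r_neq0 b2 /lt0r_neq0 b3 /lt0r_neq0 b4.
move=> E; transitivity
  (f X * g Y / ('C(#|~: A|, #|X :\: A|)%:R * 'C(#|~: X|, #|Y :\: X|)%:R)).
  by field; rewrite b1 b2.
by rewrite E; field; rewrite b3 b4.
Qed.

End ChainTriples.

(** * Families in which no member strictly contains two others *)

Section LambdaFree.
Context {R : realFieldType} {T : finType}.
Variable G : {set {set T}}.
Hypothesis G_fork : forall B C Y, B \in G -> C \in G -> Y \in G ->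
  B \proper Y -> C \proper Y -> B = C.
Implicit Types (A B C W X Y : {set T}).

Definition tops : {set {set T}} := [set X in G | [exists Y in G, Y \proper X]].
Definition bots : {set {set T}} := G :\: tops.

Definition ind (H : {set {set T}}) X : R := (X \in H)%:R.

Lemma mem_tops X Y : X \in G -> X \proper Y -> (Y \in tops) = (Y \in G).
Proof.
move=> GX XY; rewrite inE; case: (Y \in G) => //=.
by apply/existsP; exists X; rewrite GX.
Qed.

(** A larger member would contain X and the member below X. *)
Lemma tops_max X Y : X \in tops -> X \proper Y -> (Y \in G) = false.
Proof.
rewrite inE => /andP[GX /existsP[Z /andP[GZ ZX]]] XY; apply/negP => GY.
have ZX' := G_fork GZ GX GY (proper_trans ZX XY) XY.
by rewrite ZX' properxx in ZX.
Qed.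

(** The tops form an antichain, so that a chain meets at most one of them. *)
Lemma upsum_ind_tops_le (H : {set {set T}}) W : H \subset tops -> upsum (ind H) W <= 1.
Proof.
move=> /subsetP Htop; apply: upsum_le_stop => // X; rewrite /ind.
case: (boolP (X \in H)) => [HX _|]; last by rewrite eqxx.
rewrite upsumD1 HX big1 ?addr0 // => Y XY.
suff -> : (Y \in H) = false by rewrite mul0r.
apply/negP => /Htop; rewrite inE => /andP[+ _].
by rewrite (tops_max (Htop _ HX) XY).
Qed.

(** A chain meets G at most in a bottom and then in a top, and the sum on the right
    is the probability that it does both.  The proof gives a bottom X the value
    1 - upsum (ind tops) X, which makes the expected total exactly 1 from any
    member on. *)
Lemma upsum_ind_le W :
  upsum (ind G) W <= 1 + upsum (fun X => ind bots X * upsum (ind tops) X) W.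
Proof.
pose f X := ind G X + (- 1) * (ind bots X * upsum (ind tops) X).
suff : upsum f W <= 1.
  rewrite /f upsumD => le; rewrite -lerBlDr; apply: le_trans le.
  rewrite lerD2l /upsum -sumrN; apply: ler_sum => Y _.
  by rewrite mulN1r mulNr.
have bG X : X \notin G -> ind bots X = 0 by move=> GX; rewrite /ind inE (negPf GX) andbF.
apply: upsum_le_stop => // X.
have [GX _|GX] := boolP (X \in G); last by rewrite /f bG // /ind (negPf GX) mul0r mulr0 addr0 eqxx.
have fY Y : X \proper Y -> f Y = ind tops Y.
  move=> XY; rewrite /f /ind /bots in_setD (mem_tops GX XY).
  by case: (Y \in G); rewrite /= ?mul0r ?mulr0 ?addr0.
rewrite upsumD1 (eq_bigr (fun Y => ind tops Y / 'C(#|~: X|, #|Y :\: X|)%:R)); last first.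
  by move=> Y /fY->.
rewrite /f /ind upsumD1 /bots in_setD GX andbT.
have [Xt|Xb] := boolP (X \in tops) => /=; last first.
  by rewrite add0r mul1r mulN1r addrNK.
rewrite mul0r mulr0 addr0 big1 ?addr0 // => Y XY.
by rewrite inE (tops_max Xt XY) mul0r.
Qed.

End LambdaFree.

Lemma leq_bin n k : (0 < k < n)%N -> (n <= 'C(n, k))%N.
Proof.
elim: n k => [|n IH] [|k] // kn; rewrite binS.
have [lt|ge] := ltnP k.+1 n; first by rewrite -addn1 leq_add ?IH // bin_gt0; lia.
have -> : n = k.+1 by lia.
by rewrite binn binSn.
Qed.

(** * The members above a fixed set *)

Section Triples.
Context {R : realFieldType} {T : finType}.
Variables (G : {set {set T}}) (A : {set T}).
Hypothesis G_fork : forall B C Y, B \in G -> C \in G -> Y \in G ->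
  B \proper Y -> C \proper Y -> B = C.
Hypothesis GA : forall X, X \in G -> A \proper X.
Implicit Types (B C W X Y : {set T}).

Definition single : pred T := fun i => i |: A \in G.
Definition pair : rel T := fun i j => j |: (i |: A) \in G.
Definition triple i j k := k |: (j |: (i |: A)).
Definition below_triple i j k : seq {set T} :=
  [:: i |: A; j |: A; k |: A; j |: (i |: A); k |: (i |: A); k |: (j |: A)].

Lemma incidence_count i j k :
  incidence single pair i j k = count [in G] (below_triple i j k).
Proof. by rewrite /= addn0 /incidence !addnA. Qed.

Lemma pair_sym : symmetric pair.
Proof. by move=> i j; rewrite /pair setUCA. Qed.

Section Distinct.
Variables (i j k : T).
Hypotheses (iA : i \in ~: A) (jA : j \in ~: A) (kA : k \in ~: A).
Hypotheses (ij : i != j) (ik : i != k) (jk : j != k).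

(** The six sets differ in which of i, j, k they contain. *)
Lemma below_triple_uniq : uniq (below_triple i j k).
Proof.
pose bits B := (i \in B, j \in B, k \in B).
apply: (@map_uniq _ _ bits); rewrite /bits /= !in_setU1 !eqxx.
rewrite !(eq_sym j i) !(eq_sym k i) !(eq_sym k j) (negPf ij) (negPf ik) (negPf jk).
by move: iA jA kA; rewrite !inE => /negPf-> /negPf-> /negPf->.
Qed.

Lemma below_triple_proper B : B \in below_triple i j k -> B \proper triple i j k.
Proof.
move=> HB; have : B != triple i j k.
  (* B misses one of i, j, k outside A, as its membership vector shows *)
  apply/eqP => E; pose bits B := (i \in B, j \in B, k \in B).
  have : bits (triple i j k) \in map bits (below_triple i j k) by rewrite -E map_f.
  rewrite /bits /triple /= !in_setU1 !eqxx.
  rewrite !(eq_sym j i) !(eq_sym k i) !(eq_sym k j) (negPf ij) (negPf ik) (negPf jk).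
  by move: iA jA kA; rewrite !inE => /negPf-> /negPf-> /negPf->.
rewrite properEneq => ->; move: HB; rewrite !inE /triple => HB.
apply/subsetP => z; rewrite !in_setU1.
move: HB; do 5!(case/orP; first by move/eqP->; rewrite !in_setU1;
  move: (z == i) (z == j) (z == k) => [] [] []).
by move/eqP->; rewrite !in_setU1; move: (z == i) (z == j) (z == k) => [] [] [].
Qed.

Lemma below_triple_card B : B \in below_triple i j k -> (#|B :\: A| <= 2)%N.
Proof.
have le2 x y : (#|(x |: (y |: A)) :\: A| <= 2)%N.
  apply: (@leq_trans #|[set x; y]|); last by rewrite cards2; case: (x != y).
  apply/subset_leq_card/subsetP => z; rewrite !inE.
  by case: (z \in A); case: (z == x); case: (z == y).
have le1 x : (#|(x |: A) :\: A| <= 2)%N.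
  by apply: leq_trans (le2 x x); rewrite setUA setUid.
by rewrite !inE; do 5!(case/orP; first by move/eqP->); move/eqP->.
Qed.

Lemma triple_card Y : triple i j k \subset Y -> (2 < #|Y :\: A|)%N.
Proof.
move=> WY; apply: (@leq_trans #|[set i; j; k]|).
  rewrite (setUC _ [set k]) cardsU1 cards2 !inE ij.
  by rewrite !(eq_sym k) (negPf ik) (negPf jk).
apply/subset_leq_card/subsetP => z Hz; move/subsetP: WY => WY.
rewrite inE WY ?andbT /triple.
  by move: Hz iA jA kA; rewrite !inE -orbA => /or3P[] /eqP->.
by move: Hz; rewrite !inE -orbA => /or3P[] ->; rewrite ?orbT.
Qed.

Lemma no_member_above Y :
  (1 < count [in G] (below_triple i j k))%N -> triple i j k \subset Y -> Y \notin G.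
Proof.
rewrite -size_filter => c2 WY; apply/negP => GY.
have : uniq (filter [in G] (below_triple i j k)) by rewrite filter_uniq ?below_triple_uniq.
have : forall B, B \in filter [in G] (below_triple i j k) -> B \in G /\ B \proper Y.
  move=> B; rewrite mem_filter => /andP[GB /below_triple_proper BW].
  by split=> //; apply: proper_sub_trans WY.
case: filter c2 => [|B [|C l]] //= _ H; rewrite inE negb_or => /andP[/andP[/eqP[]]].
have [GB BY] := H B (mem_head _ _).
have [| GC CY] := H C; first by rewrite !inE eqxx orbT.
exact: G_fork GY BY CY.
Qed.

Lemma some_member_below Y :
  (0 < count [in G] (below_triple i j k))%N -> triple i j k \subset Y ->
  exists B, [/\ B \in G, B \proper Y & (#|B :\: A| <= 2)%N].
Proof.
rewrite -has_count => /hasP[B HB GB] WY; exists B; split=> //.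
  by apply: proper_sub_trans WY; apply: below_triple_proper.
exact: below_triple_card HB.
Qed.

End Distinct.

Lemma pair_single i j : i \in ~: A -> j \in ~: A -> i != j ->
  pair i j -> ~~ (single i && single j).
Proof.
rewrite !inE => iA jA ij Pij; apply/andP => -[Si Sj].
have iP : i |: A \proper j |: (i |: A).
  apply/properP; split; first exact: subsetUr.
  by exists j; rewrite !inE ?eqxx // eq_sym (negPf ij).
have jP : j |: A \proper j |: (i |: A).
  rewrite setUCA; apply/properP; split; first exact: subsetUr.
  by exists i; rewrite !inE ?eqxx // (negPf ij).
have /setP/(_ i) := G_fork Si Sj Pij iP jP.
by rewrite !inE eqxx (negPf ij) (negPf iA).
Qed.

(** A chain from A can meet only these bottoms at its third step or later. *)
Definition high_bots : {set {set T}} := [set X in bots G | (2 < #|X :\: A|)%N].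
Definition high_tops : {set {set T}} :=
  [set Y in tops G | [exists X in high_bots, X \proper Y]].

Local Notation ind := (@ind R T).

Lemma botsG X : X \in bots G -> X \in G.
Proof. by rewrite inE => /andP[]. Qed.

(** There is only one bottom X below a top Y, and a chain from A to Y meets it
    with probability 1 / C(y, x), where 3 <= x < y, hence C(y, x) >= y >= 4. *)
Lemma high_bots_mean Y : A \subset Y ->
  ind (tops G) Y * (\sum_(X : {set T} | (A \subset X) && (X \subset Y))
     ind high_bots X / 'C(#|Y :\: A|, #|X :\: A|)%:R) <= 4^-1 * ind high_tops Y.
Proof.
move=> AY; have [Yt|Yt] := boolP (Y \in tops G); last first.
  by rewrite /ind (negPf Yt) mul0r mulr_ge0 ?invr_ge0 ?ler0n.
have GY : Y \in G by move: Yt; rewrite inE => /andP[].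
rewrite {1}/ind Yt mul1r.
have prY X : X \in high_bots -> X \subset Y -> X \proper Y.
  rewrite 2!inE => /andP[/andP[Xt _] _] XY; rewrite properEneq XY andbT.
  by apply: contraNneq Xt => ->.
have [|no] := boolP [exists X in high_bots, X \proper Y].
  case/existsP => X /andP[HX XY].
  have GX : X \in G by move: HX; rewrite inE => /andP[/botsG].
  rewrite (bigD1 X) /=; last by rewrite (proper_sub XY) (proper_sub (GA GX)).
  rewrite big1 ?addr0 => [|X' /andP[/andP[AX' X'Y] neq]]; last first.
    rewrite /ind; case: (boolP (X' \in _)) => [HX'|_]; last by rewrite mul0r.
    have GX' : X' \in G by move: HX'; rewrite inE => /andP[/botsG].
    by rewrite (G_fork GX' GX GY (prY _ HX' X'Y) XY) eqxx in neq.
  rewrite {1}/ind HX mul1r /ind inE Yt /=.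
  have -> : [exists X in high_bots, X \proper Y] by apply/existsP; exists X; rewrite HX.
  rewrite mulr1 lef_pV2 ?posrE ?ltr0n //; last first.
    by rewrite bin_gt0 subset_leq_card // setSD // proper_sub.
  rewrite ler_nat.
  have h3 : (2 < #|X :\: A|)%N by move: HX; rewrite inE => /andP[].
  have h4 : (#|X :\: A| < #|Y :\: A|)%N.
    have /subset_leq_card := proper_sub (GA GX); have := proper_card XY.
    rewrite !cardsD (setIidPr (proper_sub (GA GX))) (setIidPr AY); lia.
  by apply: leq_trans (leq_bin (n := #|Y :\: A|) _); lia.
rewrite big1 => [|X /andP[_ XY]]; first by rewrite mulr_ge0 ?invr_ge0 ?ler0n.
rewrite /ind; case: (boolP (X \in _)) => [HX|_]; last by rewrite mul0r.
by case/negP: no; apply/existsP; exists X; rewrite HX prY.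
Qed.

Lemma card1D i : (#|(i |: A) :\: A| <= 2)%N.
Proof. by apply: (@below_triple_card i i i); rewrite inE eqxx. Qed.

Lemma card2D i j : (#|(j |: (i |: A)) :\: A| <= 2)%N.
Proof. by apply: (@below_triple_card i j i); rewrite !inE eqxx !orbT. Qed.

Lemma high_bots_low X : (#|X :\: A| <= 2)%N -> ind high_bots X = 0.
Proof. by rewrite leqNgt => /negPf X2; rewrite /ind inE X2 andbF. Qed.

Lemma high_tops_low X : (#|X :\: A| <= 2)%N -> ind high_tops X = 0.
Proof.
rewrite /ind leqNgt; case: (boolP (X \in _)) => // /[!inE] /andP[_ /existsP[Z]].
rewrite !inE => /andP[/andP[_ Z2] ZX] /negP[]; apply: leq_trans Z2 _.
by rewrite subset_leq_card // setSD // proper_sub.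
Qed.

(** Given the triple, the hits before it are worth [single i] + [pair i j], of mean
    l / 3 over the orderings of the triple; the hits from it on are worth at
    most 1 when l <= 1, plus the probability of meeting a bottom and a top.  The
    latter is bounded on average by a quarter of the probability of meeting a
    high top, which forces l = 0. *)
Lemma upsum_tsum_payoff :
  (#|~: A| * #|~: A|.-1 * #|~: A|.-2)%:R * upsum (ind G) A <=
  tsum (~: A) (fun i j k => payoff (incidence single pair i j k)) :> R.
Proof.
set V := ~: A; set m3 := (_ * _ * _)%:R.
pose c i j k := incidence single pair i j k.
pose both X := ind (bots G) X * upsum (ind (tops G)) X.
pose h X := ind high_bots X * upsum (ind (tops G)) X.
have A0 (H : {set {set T}}) : {subset H <= G} -> ind H A = 0.
  by move=> HG; rewrite /ind; case: (boolP (A \in _)) => // /HG/GA; rewrite properxx.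
have D0 : (#|A :\: A| <= 2)%N by rewrite setDv cards0.
(* [both] and [h] agree above a triple, and [h] vanishes strictly below it *)
have both_h : tsum V (fun i j k => upsum both (triple i j k)) = m3 * upsum h A.
  rewrite -upsum_triple; apply: eq_tsum => i j k iV jV kV ij ik jk.
  rewrite /h !high_bots_low ?card1D ?card2D // !mul0r !add0r.
  apply: eq_upsum => Y WY; rewrite /both /h; congr (_ * _).
  by rewrite /ind !inE (triple_card iV jV kV ij ik jk WY) andbT.
have h_tops : upsum h A <= 4^-1 * upsum (ind high_tops) A.
  by rewrite /h upsum_comp -upsumZ; apply: ler_upsum => Y; apply: high_bots_mean.
have tops_c : m3 * upsum (ind high_tops) A <= tsum V (fun i j k => (c i j k == 0%N)%:R).
  rewrite -upsum_triple; apply: ler_tsum => i j k iV jV kV ij ik jk.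
  rewrite !high_tops_low ?card1D ?card2D // !add0r.
  have [c0|c0] := eqVneq (c i j k) 0%N.
    by apply: (upsum_ind_tops_le G_fork); apply/subsetP => X; rewrite inE => /andP[].
  rewrite upsum_eq0 // => Y WY; rewrite /ind; case: (boolP (Y \in _)) => //.
  rewrite !inE => /andP[/andP[GY _] /existsP[X /andP[HX XY]]].
  have GX : X \in G by move: HX; rewrite inE => /andP[/botsG].
  have [|B [GB BY]] := some_member_below iV jV kV ij ik jk _ WY.
    by rewrite -incidence_count lt0n.
  rewrite (G_fork GB GX GY BY XY); move: HX; rewrite inE => /andP[_].
  by rewrite ltnNge => /negP.
have main : m3 * upsum (ind G) A <=
   tsum V (fun i j k => (single i)%:R + (pair i j)%:R + (c i j k <= 1)%N%:R
                        + upsum both (triple i j k)).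
  rewrite -upsum_triple; apply: ler_tsum => i j k iV jV kV ij ik jk.
  rewrite A0 // add0r -[leRHS]addrA; apply: lerD; first exact: lexx.
  have [c1|c1] := leqP (c i j k) 1; first exact: (upsum_ind_le G_fork).
  rewrite upsum_eq0 ?add0r => [|Y WY].
    apply: upsum_ge0 => Y _; rewrite mulr_ge0 ?ler0n //.
    by apply: upsum_ge0 => Z _; rewrite ler0n.
  rewrite /ind (negPf (no_member_above iV jV kV ij ik jk _ WY)) //.
  by rewrite -incidence_count.
apply: le_trans main _; rewrite !tsumD both_h.
have tsumV (r : R) H : tsum V (fun i j k => H i j k / r) = r^-1 * tsum V H.
  by rewrite -tsumZ; apply: eq_tsum => *; rewrite mulrC.
set ts := tsum V (fun i _ _ => (single i)%:R); set tp := tsum V (fun i j _ => (pair i j)%:R).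
have s2 : tsum V (fun _ j _ => (single j)%:R) = ts.
  exact: (tsum_swap12 V (fun i _ _ => (single i)%:R)).
have s3 : tsum V (fun _ _ k => (single k)%:R) = ts.
  by rewrite -s2; exact: (tsum_swap23 V (fun _ j _ => (single j)%:R)).
have p2 : tsum V (fun i _ k => (pair i k)%:R) = tp.
  exact: (tsum_swap23 V (fun i j _ => (pair i j)%:R)).
have p3 : tsum V (fun _ j k => (pair j k)%:R) = tp.
  by rewrite -p2; exact: (tsum_swap12 V (fun i _ k => (pair i k)%:R)).
have tsum_incidence :
    tsum V (fun i j k => (incidence single pair i j k)%:R) = ts + ts + ts + tp + tp + tp.
  rewrite -{2}s2 -{2}s3 -{2}p2 -{2}p3 -!tsumD.
  by apply: eq_tsum => *; rewrite !natrD.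
rewrite !tsumV tsum_incidence -/c.
have : m3 * upsum h A <= 4^-1 * (m3 * upsum (ind high_tops) A).
  by rewrite mulrCA ler_wpM2l // ler0n.
lra.
Qed.

End Triples.

(** * Diamond-free families *)

Lemma bin_le_mid n k : ('C(n, k) <= 'C(n, n./2))%N.
Proof.
have low j : ('C(n, n./2 - j) <= 'C(n, n./2))%N.
  elim: j => [|j IH]; first by rewrite subn0.
  apply: leq_trans IH; have [lt|ge] := ltnP j n./2; last first.
    by rewrite (_ : n./2 - j.+1 = n./2 - j)%N //; lia.
  have -> : (n./2 - j = (n./2 - j.+1).+1)%N by lia.
  set i := (n./2 - j.+1)%N; rewrite -(leq_pmul2l (ltn0Sn i)) mul_bin_left.
  by rewrite leq_mul2r; apply/orP; right; lia.
have [le|gt] := leqP k n./2.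
  by have := low (n./2 - k)%N; rewrite subKn.
have [le|gt'] := leqP k n; last by rewrite bin_small.
by rewrite -bin_sub //; have := low (n./2 - (n - k))%N; rewrite subKn //; lia.
Qed.

Section DiamondFree.
Context {R : realFieldType} {T : finType}.
Variables (F : {set {set T}}).
Hypothesis F_free : ~ exists A B C D : {set T},
  [/\ uniq [:: A; B; C; D],
      [/\ A \in F, B \in F, C \in F & D \in F],
      A \proper B /\ B \proper D & A \proper C /\ C \proper D].

(** The bound for chains from A has an error of order 1 / #|~: A|, so A must be
    far from the full set. *)
Definition deep (m : nat) : {set {set T}} := [set X in F | (m <= #|~: X|)%N].

(** The slack 2.283261 - 1 - 41/32 exceeds 9 / (32 * 147), which bounds the error
    (9/32) m^2 / (m (m - 1) (m - 2)) for m >= 150. *)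
Lemma upsum_deep_le X : @upsum R T (ind (deep 150)) X <= 2 + 283 / 10 ^+ 3 + 261 / 10 ^+ 6.
Proof.
apply: upsum_le_stop => [|A]; first lra.
rewrite {1}/ind; case: (boolP (A \in deep 150)) => [FA _|]; last by rewrite eqxx.
pose G := [set Y in deep 150 | A \proper Y].
have fork B C Y : B \in G -> C \in G -> Y \in G -> B \proper Y -> C \proper Y -> B = C.
  rewrite !inE => /andP[/andP[FB _] AB] /andP[/andP[FC _] AC] /andP[/andP[FY _] AY] BY CY.
  apply/eqP/negPn/negP => BC; apply: F_free; exists A, B, C, Y; split=> //.
    rewrite /= !inE !negb_or BC (proper_neq AB) (proper_neq AC) (proper_neq AY).
    by rewrite (proper_neq BY) (proper_neq CY).
  by split=> //; move: FA; rewrite inE => /andP[].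
have GA Y : Y \in G -> A \proper Y by rewrite inE => /andP[].
have -> : @upsum R T (ind (deep 150)) A = 1 + upsum (ind G) A.
  rewrite !upsumD1 /ind FA inE properxx andbF add0r; congr (_ + _).
  by apply: eq_bigr => Y AY; rewrite [in RHS]inE AY andbT.
have := upsum_tsum_payoff (R := R) fork GA.
have mA : (150 <= #|~: A|)%N by move: FA; rewrite inE => /andP[].
have := tsum_payoff_le (R := R) (@pair_sym T G A) (@pair_single T G A fork).
move=> h1 h2; have {h1 h2} := le_trans h2 h1.
have : (147 * #|~: A| ^ 2 <= #|~: A| * #|~: A|.-1 * #|~: A|.-2)%N.
  move: mA; case: #|~: A| => [|[|m]] //= m150; rewrite expnS expn1.
  by rewrite [leqRHS]mulnAC [leqLHS]mulnA mulnC -mulnA; nia.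
rewrite -(ler_nat R) natrM.
have : (0 : R) < (#|~: A| * #|~: A|.-1 * #|~: A|.-2)%:R by rewrite ltr0n; nia.
move: (_ * _ * _)%:R (_ ^ 2)%:R (upsum _ _) => p q u p0 qp up.
have : u <= 41 / 32 + 9 / 32 / 147.
  rewrite -(ler_pM2l p0); apply: le_trans up _; rewrite mulrDr; lra.
lra.
Qed.

Lemma card_deep_le :
  #|deep 150|%:R <= (2 + 283 / 10 ^+ 3 + 261 / 10 ^+ 6) * 'C(#|T|, #|T|./2)%:R :> R.
Proof.
have N0 : (0 : R) < 'C(#|T|, #|T|./2)%:R by rewrite ltr0n bin_gt0; lia.
rewrite -ler_pdivrMr //; apply: le_trans (upsum_deep_le set0).
rewrite /upsum -sum1_card natr_sum mulr_suml big_mkcond /=.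
rewrite [leRHS](eq_bigl xpredT) => [|Y]; last by rewrite sub0set.
apply: ler_sum => Y _; rewrite /ind setC0 setD0 cardsT.
case: (boolP (Y \in _)) => _; last by rewrite mul0r.
by rewrite ler_pM2l // lef_pV2 ?ler_nat ?bin_le_mid // posrE ?ltr0n // bin_gt0 max_card.
Qed.

Lemma card_high_sets m :
  #|[set X : {set T} | (#|~: X| < m)%N]| = (\sum_(k < m) 'C(#|T|, k))%N.
Proof.
rewrite -sum1_card.
rewrite (partition_big (fun X : {set T} => inord #|~: X| : 'I_m.-1.+1) xpredT) //=.
case: m => [|m]; first by rewrite !big_ord0 big1 // => k _; rewrite big_pred0 // => X; rewrite inE.
apply: eq_bigr => k _; rewrite sum1_card -card_draws -[RHS](card_imset _ (@setC_inj T)).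
apply: eq_card => X; rewrite -[X in RHS]setCK mem_imset ?inE; last exact: setC_inj.
rewrite unfold_in inE -val_eqE /=; case: (ltnP #|~: X| m.+1) => [lt|ge].
  by rewrite inordK.
by apply/esym/eqP => E; have := ltn_ord k; rewrite ltnS leqNgt -E ge.
Qed.

Lemma card_diamond_free_le :
  #|F|%:R <= (2 + 283 / 10 ^+ 3 + 261 / 10 ^+ 6) * 'C(#|T|, #|T|./2)%:R
             + (\sum_(k < 150) 'C(#|T|, k))%N%:R :> R.
Proof.
apply: le_trans (lerD card_deep_le (lexx _)).
rewrite -natrD ler_nat -card_high_sets.
rewrite -(cardsID (deep 150) F) leq_add ?subset_leq_card ?subsetIr //.
by apply/subsetP => X; rewrite !inE; case: (X \in F); rewrite ?andbF // -ltnNge andbT.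
Qed.

End DiamondFree.

(** * Two layers, and the asymptotics *)

Definition two_layers n k : {set {set 'I_n}} := [set X : {set 'I_n} | (k <= #|X| <= k.+1)%N].

Lemma two_layers_Q2_free n k : Q2_free (two_layers n k).
Proof.
apply/Q2_freeE => -[A [B [C [D [_ [FA FB FC FD] [AB BD] _]]]]].
move: FA FD (proper_card AB) (proper_card BD); rewrite !inE; lia.
Qed.

Lemma card_two_layers n k : #|two_layers n k| = ('C(n, k) + 'C(n, k.+1))%N.
Proof.
have -> : two_layers n k =
    [set X : {set 'I_n} | #|X| == k] :|: [set X : {set 'I_n} | #|X| == k.+1].
  by apply/setP => X; rewrite !inE; lia.
rewrite cardsU !card_draws card_ord -[RHS]subn0; congr (_ - _)%N.
by apply/eqP; rewrite cards_eq0; apply/eqP/setP => X; rewrite !inE; lia.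
Qed.

(** The ratio of the two coefficients is (n - h) / (h + 1) with h = n./2, at least
    1 - 1 / (h + 1). *)
Lemma binS_half_mid n : ((n.+1) * ('C(n, n./2) - 'C(n, n./2.+1)) <= 2 * 'C(n, n./2))%N.
Proof.
have := mul_bin_left n n./2; have := bin_le_mid n n./2.+1.
have := odd_double_half n; move: 'C(n, n./2) 'C(n, n./2.+1) n./2 => N M h.
by case: (odd n) => <-; rewrite -muln2; nia.
Qed.

(** C(n, k) = (k + 1) / (n - k) C(n, k + 1), and C(n, k + 1) is at most the middle
    coefficient: one step towards the middle already gains a factor of order n. *)
Lemma bin_small_mid n m k : (k < m)%N -> (2 * m <= n.+1)%N ->
  (n.+1 * 'C(n, k) <= 2 * m * 'C(n, n./2))%N.
Proof.
move=> km mn; have := mul_bin_left n k; have := bin_le_mid n k.+1.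
move: 'C(n, n./2) 'C(n, k) 'C(n, k.+1) => N b c; nia.
Qed.

Lemma sum_bin_small_mid n m : (2 * m <= n.+1)%N ->
  (n.+1 * (\sum_(k < m) 'C(n, k)) <= (2 * m ^ 2) * 'C(n, n./2))%N.
Proof.
move=> mn; rewrite big_distrr /=.
apply: (@leq_trans (\sum_(k < m) 2 * m * 'C(n, n./2))).
  by apply: leq_sum => k _; apply: bin_small_mid.
by rewrite sum_nat_const card_ord; apply/eq_leq; rewrite expnS expn1; ring.
Qed.

From mathcomp Require Import all_classical all_reals all_analysis.
Import numFieldNormedType.Exports.

Lemma is_little_o_midbin (R : realType) (u : nat -> nat) (K m : nat) :
  (forall n, (m <= n)%N -> (n.+1 * u n <= K * midbin n)%N) ->
  is_little_o (fun n => (u n)%:R) (fun n => (midbin n)%:R : R).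
Proof.
move=> uK; rewrite /is_little_o.
apply: (@squeeze_cvgr _ _ _ _ (cst 0) (fun n => K%:R * harmonic n)).
- exists m => // n /= /uK un.
  have N0 : (0 : R) < (midbin n)%:R by rewrite ltr0n bin_gt0; lia.
  rewrite divr_ge0 ?ler0n //= ler_pdivrMr // mulrAC ler_pdivlMr ?ltr0n //.
  by rewrite -!natrM ler_nat mulnC.
- exact: cvg_cst.
- have := @cvgM R _ _ _ _ _ _ _ (cvg_cst (K%:R : R)) (@cvg_harmonic R); rewrite mulr0; exact.
Qed.

Unset Implicit Arguments.

(* 2 + 283 / 10 ^+ 3 + 261 / 10 ^+ 6 is the decimal constant 2.283261 *)
Theorem theorem1 (R : realType) :
  let N : nat -> R := fun n => (midbin n)%:R in
  exists g h : nat -> R,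
    [/\ is_little_o g N, is_little_o h N &
      forall n : nat,
        2 * N n - g n <= (ex_Q2 n)%:R /\
        (ex_Q2 n)%:R <= (2 + 283 / 10 ^+ 3 + 261 / 10 ^+ 6) * N n + h n].
Proof.
move=> N.
exists (fun n => ('C(n, n./2) - 'C(n, n./2.+1))%:R).
exists (fun n => (\sum_(k < 150) 'C(n, k))%N%:R); split.
- by apply: (@is_little_o_midbin R _ 2 0) => n _; apply: binS_half_mid.
- apply: (@is_little_o_midbin R _ (2 * 150 ^ 2) 300) => n n300.
  by apply: sum_bin_small_mid; lia.
- move=> n; split.
    rewrite /N /midbin -natrM natrB ?bin_le_mid //.
    have := leq_ex_Q2 (two_layers_Q2_free (n := n) (k := n./2)).
    rewrite card_two_layers -(ler_nat R) natrD natrM; lra.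
  have [F /Q2_freeE F_free <-] := ex_Q2_attained n.
  by have := card_diamond_free_le (R := R) F_free; rewrite card_ord.
Qed.
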